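(* Let $V=\{e^{(1)},\dots,e^{(n)}\}$ be a finite set and $f:\{0,1,2,3\}^V\to\mathbb{R}_{\ge 0}$ a nonnegative $3$-submodular function with maximizer $\boldsymbol{o}$. Consider the following randomized algorithm. Start with $\boldsymbol{s}=\boldsymbol{0}$. For $t=1,\dots,n$: compute $y_i=\Delta_{e^{(t)},i}f(\boldsymbol{s})$ for $i\in\{1,2,3\}$; relabel the indices by a permutation so that $y_1\ge y_2\ge y_3$; put $\beta=y_2/y_1$, $\gamma=y_3/y_1$, $\delta=\frac{1-\beta-\gamma}{2}+\frac{\beta}{1+\gamma}-\frac{\gamma}{\beta+\gamma}$; if $\gamma\le 0$ set $p_1=\frac{1}{1+\beta}$, $p_2=\frac{\beta}{1+\beta}$, $p_3=0$; else if $\delta>0$ set $p_1=\frac{1+\gamma}{1+\beta+2\gamma}$, $p_2=\frac{\beta+\gamma}{1+\beta+2\gamma}$, $p_3=0$; otherwise set $p_1=\frac{2-\beta+\gamma}{2+\beta+3\gamma}$, $p_2=p_3=\frac{\beta+\gamma}{2+\beta+3\gamma}$; then set $\boldsymbol{s}(e^{(t)})=i$ with probability $p_i$ (with respect to the relabeled indices). Output $\boldsymbol{s}$. Then $\mathbb{E}[f(\boldsymbol{s})]\ge\frac{\sqrt{17}-3}{2}f(\boldsymbol{o})$.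
   Context: Vectors $\boldsymbol{x}\in\{0,1,\dots,k\}^V$ are identified with $k$-tuples $(X_1,\dots,X_k)$ of pairwise disjoint subsets of $V$ via $X_i=\{e:\boldsymbol{x}(e)=i\}$. For $\boldsymbol{x},\boldsymbol{y}$, define $(\boldsymbol{x}\sqcap\boldsymbol{y})(e)=\boldsymbol{x}(e)$ if $\boldsymbol{x}(e)=\boldsymbol{y}(e)$ and $0$ otherwise; and $(\boldsymbol{x}\sqcup\boldsymbol{y})(e)=i$ if $\{\boldsymbol{x}(e),\boldsymbol{y}(e)\}\setminus\{0\}=\{i\}$ and $0$ otherwise. A function $f$ on $\{0,\dots,k\}^V$ is $k$-submodular if $f(\boldsymbol{x})+f(\boldsymbol{y})\ge f(\boldsymbol{x}\sqcap\boldsymbol{y})+f(\boldsymbol{x}\sqcup\boldsymbol{y})$ for all $\boldsymbol{x},\boldsymbol{y}$; here $k=3$. For $\boldsymbol{x}$ with $\boldsymbol{x}(e)=0$, $\Delta_{e,i}f(\boldsymbol{x})=f(\boldsymbol{x}')-f(\boldsymbol{x})$ where $\boldsymbol{x}'$ agrees with $\boldsymbol{x}$ except $\boldsymbol{x}'(e)=i$. The input function of the maximization problem is assumed nonnegative throughout the paper. *)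

(* Defs.v *)
From HB Require Import structures.
From mathcomp Require Import all_boot all_order perm all_algebra.
From mathcomp Require Import reals.

Set Implicit Arguments.
Unset Strict Implicit.
Unset Printing Implicit Defensive.

Import Order.TTheory GRing.Theory Num.Theory.
Local Open Scope ring_scope.

(* A vector in {0, ..., k}^V; the value [ord0] stands for "unassigned". *)
Notation kvec k V := {ffun V -> 'I_k.+1}.

Section KSubmodular.
Variables (V : finType) (k : nat) (R : realType).
Implicit Types (x y : kvec k V) (f : kvec k V -> R).

Definition kmeet x y : kvec k V :=
  [ffun e => if x e == y e then x e else ord0].

(* [unset1 A] is [Some i] when A = {i}, and [None] when A is not a singleton. *)
Definition kjoin x y : kvec k V :=
  [ffun e => odflt ord0 (unset1 ([set x e; y e] :\ ord0))].

Definition ksubmodular f : Prop :=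
  forall x y, f (kmeet x y) + f (kjoin x y) <= f x + f y.

Definition kassign x (e : V) (i : 'I_k.+1) : kvec k V :=
  [ffun v => if v == e then i else x v].

(* Only meaningful when [x e = ord0]. *)
Definition marginal f (e : V) (i : 'I_k.+1) x : R := f (kassign x e i) - f x.

End KSubmodular.

Section Algorithm.
Variables (V : finType) (R : realType).
Implicit Types (f : kvec 3 V -> R) (s : kvec 3 V) (e : V).

(* The labels 1, 2, 3 are indexed by 'I_3, shifted by one into 'I_4, and the
   relabelled indices 1, 2, 3 are the positions 0, 1, 2 : 'I_3. *)
Definition label (i : 'I_3) : 'I_4 := lift ord0 i.

(* [sigma j] is the original index of the one that is relabelled [j]. *)
Definition relabelled_gain f e s (sigma : 'S_3) (j : 'I_3) : R :=
  marginal f e (label (sigma j)) s.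

Definition sorts_gains f e s (sigma : 'S_3) : Prop :=
  forall i j : 'I_3, (i <= j)%N ->
    relabelled_gain f e s sigma j <= relabelled_gain f e s sigma i.

Definition delta (beta gamma : R) : R :=
  (1 - beta - gamma) / 2 + beta / (1 + gamma) - gamma / (beta + gamma).

Definition probs (beta gamma : R) : seq R :=
  if gamma <= 0 then
    [:: 1 / (1 + beta); beta / (1 + beta); 0]
  else if 0 < delta beta gamma then
    [:: (1 + gamma) / (1 + beta + 2 * gamma);
        (beta + gamma) / (1 + beta + 2 * gamma);
        0]
  else
    [:: (2 - beta + gamma) / (2 + beta + 3 * gamma);
        (beta + gamma) / (2 + beta + 3 * gamma);
        (beta + gamma) / (2 + beta + 3 * gamma)].

(* For a 3-submodular f, y1 = 0 forces y2 = y3 = 0; the ratios 0 / 0 are then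
   0, so that index 1 is chosen with probability 1. *)
Definition choice_prob f e s (sigma : 'S_3) (j : 'I_3) : R :=
  let y1 := relabelled_gain f e s sigma 0 in
  let y2 := relabelled_gain f e s sigma 1 in
  let y3 := relabelled_gain f e s sigma 2 in
  (probs (y2 / y1) (y3 / y1))`_j.

(* Probability mass functions on {0, 1, 2, 3}^V. *)
Definition pmf := {ffun kvec 3 V -> R}.

Definition initial_law : pmf :=
  [ffun x => (x == [ffun=> ord0])%:R].

(* The law of s after e has been processed, from the law [mu] of s before;
   [rule e s] is the relabelling permutation used when e is processed with
   current vector s. *)
Definition step_law f (rule : V -> kvec 3 V -> 'S_3) (mu : pmf) e : pmf :=
  [ffun x => \sum_s mu s *
     \sum_(j < 3) choice_prob f e s (rule e s) j *
       (x == kassign s e (label (rule e s j)))%:R].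

Definition output_law f rule (es : seq V) : pmf :=
  foldl (step_law f rule) initial_law es.

Definition expectation (mu : pmf) f : R := \sum_x mu x * f x.

End Algorithm.

(* Main.v *)
Require Import Defs.
From HB Require Import structures.
From mathcomp Require Import all_boot all_order perm all_algebra.
From mathcomp Require Import reals.
From mathcomp Require Import ring lra.

Set Implicit Arguments.
Unset Strict Implicit.
Unset Printing Implicit Defensive.

Import Order.TTheory GRing.Theory Num.Theory.
Local Open Scope ring_scope.

(* Let [c = (sqrt 17 - 1) / 4], the positive root of [2 c^2 + c = 2], so that the
   claimed ratio is [1 / (1 + c)].  While the elements [es] are still to be
   processed, let [hybrid es s] follow [o] on [es] and the current vector [s]
   elsewhere.  The potential [f (hybrid es s) + c f s] is at least [f o] at the
   start and is [(1 + c) f s] at the end, so it suffices that no step decreases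
   its expectation.
   Orthant submodularity bounds the gains [b_i] at the hybrid vector by the gains
   [y_i] at [s], and pairwise monotonicity makes the sum of two gains at the same
   vector nonnegative; it remains to prove an inequality in
   [beta = y_2 / y_1] and [gamma = y_3 / y_1].  For [gamma > 0] it reduces to
   [num1 <= c den1] for the two-point distribution and to [num2 <= c den2] for
   the three-point one; the sign of [delta] selects the smaller of the ratios
   [num1 / den1] and [num2 / den2], and these meet in the value [c] at
   [beta = 1], [gamma = (sqrt 17 - 3) / 2]. *)

(** * Real inequalities for one step, in normalized gains *)

Section StepInequality.
Variable R : realType.
Implicit Types beta gamma c : R.

(** Multiplying [delta] by the positive [2 (1 + gamma) (beta + gamma)^2] gives
    [num2 den1 - num1 den2], so its sign compares the two ratios. *)
Lemma delta_gt0E beta gamma : 0 < gamma -> gamma <= beta ->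
  (0 < delta beta gamma) =
  ((1 + gamma) * (beta + gamma) * (2 - beta + gamma + (beta + gamma) ^+ 2) <
   2 * (beta + gamma) * (1 + gamma + beta * (beta + gamma))).
Proof.
move=> g0 gb.
have d1 : 0 < 1 + gamma by lra.
have d2 : 0 < beta + gamma by lra.
rewrite -[RHS]subr_gt0.
have -> : 2 * (beta + gamma) * (1 + gamma + beta * (beta + gamma)) -
   (1 + gamma) * (beta + gamma) * (2 - beta + gamma + (beta + gamma) ^+ 2)
  = (2 * (1 + gamma) * (beta + gamma) ^+ 2) * delta beta gamma.
  by rewrite /delta; field; rewrite !gt_eqF.
by rewrite pmulr_rgt0 // !mulr_gt0 // exprn_gt0.
Qed.

(** The branch taken has the smaller ratio, so it suffices that the two ratios never both exceed
    [c]; this is [key]. *)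
Lemma two_point_or_three_point beta gamma c :
    0 < c -> 2 * c ^+ 2 + c = 2 -> 0 < gamma -> gamma <= beta -> beta <= 1 ->
  if 0 < delta beta gamma
  then (1 + gamma) * (beta + gamma) <= c * (1 + gamma + beta * (beta + gamma))
  else 2 * (beta + gamma) <= c * (2 - beta + gamma + (beta + gamma) ^+ 2).
Proof.
move=> c0 cE g0 gb b1; rewrite delta_gt0E //.
set num1 := _ * (beta + gamma); set den2 := 2 - _ + _ + _.
set num2 := 2 * _; set den1 := 1 + gamma + _.
have den1_gt0 : 0 < den1 by rewrite /den1; nra.
have den2_gt0 : 0 < den2 by rewrite /den2; nra.
have key : c * den2 < num2 -> num1 < c * den1.
  move=> G2.
  (* The weights [c] and [1] make the combination vanish identically at
     [beta = 1], where the worst case lies. *)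
  have G12 : c * (c * den1 - num1) + (c * den2 - num2)
    = (1 - beta) * (1 - (beta + gamma) + c * (3 - (beta + gamma)) / 2).
    have cc : c * c = 1 - c / 2 by rewrite -expr2; lra.
    rewrite mulrBr mulrA cc.
    by rewrite /den1 /num1 /den2 /num2; field.
  (* Put [s = beta + gamma]. As [beta <= 1], [den2] is at least [s + s^2], so [G2] gives
     [c (1 + s) < 2], while [s > 2 c] would give [c (1 + s) > c + 2 c^2 = 2]. *)
  have sle : beta + gamma <= 2 * c.
    rewrite leNgt; apply/negP => sgt.
    have : 0 <= (beta + gamma) * (c + c * (beta + gamma) - 2).
      by apply: mulr_ge0; nra.
    by move: G2; rewrite /den2 /num2; nra.
  (* The second factor decreases in [beta + gamma] and vanishes at [2 c]. *)
  have : 0 <= (1 - beta) * (1 - (beta + gamma) + c * (3 - (beta + gamma)) / 2).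
    by apply: mulr_ge0; nra.
  rewrite -G12 => h.
  have : 0 < c * (c * den1 - num1) by lra.
  by rewrite pmulr_rgt0 // subr_gt0.
case: ifPn => [lt21|]; [|rewrite -leNgt => le12]; rewrite leNgt; apply/negP => G.
- case: (ltP (c * den2) num2) => [/key|]; nra.
- by have := key G; nra.
Qed.

(** The scaling makes [y_1 = 1]. For [gamma > 0], with denominators cleared, the terms in [c] add up
    to [c den1] or [c den2], and bounds such as [b2 >= - b3 >= - gamma] limit the remaining loss to
    [num1] or [num2]. *)
Lemma normalized_step beta gamma b1 b2 b3 c (p := probs beta gamma) :
    0 < c -> 2 * c ^+ 2 + c = 2 ->
    gamma <= beta -> beta <= 1 -> 0 <= beta + gamma ->
    b1 <= 1 -> b2 <= beta -> b3 <= gamma ->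
    0 <= b1 + b2 -> 0 <= b1 + b3 -> 0 <= b2 + b3 ->
  forall b, b \in [:: b1; b2; b3] ->
  b <= p`_0 * (b1 + c) + p`_1 * (b2 + c * beta) + p`_2 * (b3 + c * gamma).
Proof.
move=> c0 cE gb le_b1 bg b1le b2le b3le b12 b13 b23 b bE.
have c2 : 1 <= 2 * c by nra.
have weighted q1 q2 q3 D : 0 < D ->
    D * b <= q1 * (b1 + c) + q2 * (b2 + c * beta) + q3 * (b3 + c * gamma) ->
  b <= q1 / D * (b1 + c) + q2 / D * (b2 + c * beta) + q3 / D * (b3 + c * gamma).
  move=> D0 h; rewrite ![_ / D * _]mulrAC -!mulrDl ler_pdivlMr //.
  by rewrite mulrC.
rewrite {}/p /probs; case: ifPn => [g0|]; last first.
  rewrite -ltNge => g0; have := two_point_or_three_point c0 cE g0 gb le_b1.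
  case: ifP => _ key /=.
    rewrite -[X in X * (b3 + _)](mul0r (1 + beta + 2 * gamma)^-1).
    apply: weighted; first by lra.
    move: bE; rewrite !inE => /or3P[] /eqP->; nra.
  apply: weighted; first by lra.
  move: bE; rewrite !inE => /or3P[] /eqP->; nra.
(* Here [b3 <= gamma <= 0] makes [b1] and [b2] nonnegative, so the loss is at most
   [beta <= 2 c beta <= c (1 + beta^2)]. *)
rewrite /= -[X in X * (b3 + _)](mul0r (1 + beta)^-1).
apply: weighted; first by lra.
move: bE; rewrite !inE => /or3P[] /eqP->; nra.
Qed.

Lemma sum_ord3 (F : 'I_3 -> R) : \sum_(j < 3) F j = F 0 + F 1 + F 2.
Proof.
rewrite !big_ord_recl big_ord0 addr0 addrA.
by congr (F _ + F _ + F _); apply: val_inj.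
Qed.

Lemma probs_step (y b : 'I_3 -> R) c (p := probs (y 1 / y 0) (y 2 / y 0)) :
    0 < c -> 2 * c ^+ 2 + c = 2 ->
    (forall i j : 'I_3, (i <= j)%N -> y j <= y i) ->
    (forall i j, i != j -> 0 <= y i + y j) ->
    (forall i, b i <= y i) -> (forall i j, i != j -> 0 <= b i + b j) ->
  forall k, b k <= \sum_(j < 3) p`_j * (b j + c * y j).
Proof.
move=> c0 cE y_sorted y_pair b_le b_pair k.
have k3 : k \in ([:: 0; 1; 2] : seq 'I_3).
  by case: k => [[|[|[]]]].
have y10 : y 1 <= y 0 by exact: y_sorted.
have y21 : y 2 <= y 1 by exact: y_sorted.
have y12 : 0 <= y 1 + y 2 by exact: y_pair.
have b01 : 0 <= b 0 + b 1 by exact: b_pair.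
have b02 : 0 <= b 0 + b 2 by exact: b_pair.
have b12 : 0 <= b 1 + b 2 by exact: b_pair.
have b0 := b_le 0; have b1 := b_le 1; have b2 := b_le 2.
(* If [y 0 = 0], the order and the pairwise sums force all [y j], and then all [b j], to be [0]. *)
rewrite sum_ord3 {}/p; have [y0|y0] := eqVneq (y 0) 0.
  have [Y1 Y2] : y 1 = 0 /\ y 2 = 0 by split; lra.
  have [B0 [B1 B2]] : b 0 = 0 /\ b 1 = 0 /\ b 2 = 0 by do 2?split; lra.
  rewrite y0 Y1 Y2 B0 B1 B2 mulr0 addr0 !mulr0 !addr0.
  by move: k3; rewrite !inE => /or3P[] /eqP->; rewrite ?B0 ?B1 ?B2.
have {}y0 : 0 < y 0 by rewrite lt_def y0; lra.
have div_le u v : (u / y 0 <= v / y 0) = (u <= v) by rewrite ler_pM2r ?invr_gt0.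
have div_ge0 u v : (0 <= u / y 0 + v / y 0) = (0 <= u + v).
  by rewrite -mulrDl pmulr_lge0 ?invr_gt0.
have le1 u : (u / y 0 <= 1) = (u <= y 0) by rewrite ler_pdivrMr ?mul1r.
have := @normalized_step (y 1 / y 0) (y 2 / y 0)
  (b 0 / y 0) (b 1 / y 0) (b 2 / y 0) c c0 cE.
rewrite !div_le !div_ge0 !le1 => /(_ y21 y10 y12 b0 b1 b2 b01 b02 b12 (b k / y 0)).
have -> : b k / y 0 \in [:: b 0 / y 0; b 1 / y 0; b 2 / y 0].
  by move: k3; rewrite !inE => /or3P[] /eqP->; rewrite eqxx ?orbT.
move=> /(_ isT); rewrite ler_pdivrMr // => /le_trans; apply.
by rewrite le_eqVlt; apply/orP; left; apply/eqP; field; rewrite gt_eqF.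
Qed.

Lemma probs_ge0 beta gamma (j : nat) :
  gamma <= beta -> beta <= 1 -> 0 <= beta + gamma -> 0 <= (probs beta gamma)`_j.
Proof.
move=> gb b1 bg; rewrite /probs.
case: ifPn => [g0|]; last rewrite -ltNge => g0; last case: ifP => _.
all: case: j => [|[|[|j]]] //=; rewrite ?nth_nil //.
all: by apply: divr_ge0; lra.
Qed.

Lemma probs_sum beta gamma :
  gamma <= beta -> beta <= 1 -> 0 <= beta + gamma ->
  \sum_(j < 3) (probs beta gamma)`_j = 1.
Proof.
move=> gb b1 bg; rewrite sum_ord3 /probs.
case: ifPn => [g0|]; last rewrite -ltNge => g0; last case: ifP => _.
all: by rewrite /=; field; rewrite gt_eqF //; lra.
Qed.

Lemma gain_ratios (y : 'I_3 -> R) :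
    (forall i j : 'I_3, (i <= j)%N -> y j <= y i) ->
    (forall i j, i != j -> 0 <= y i + y j) ->
  [/\ y 2 / y 0 <= y 1 / y 0, y 1 / y 0 <= 1 & 0 <= y 1 / y 0 + y 2 / y 0].
Proof.
move=> y_sorted y_pair.
have y10 : y 1 <= y 0 by exact: y_sorted.
have y21 : y 2 <= y 1 by exact: y_sorted.
have y12 : 0 <= y 1 + y 2 by exact: y_pair.
(* Division by zero yields [0], so the bounds survive [y 0 = 0]. *)
have [->|y0] := eqVneq (y 0) 0; first by rewrite invr0 !mulr0 addr0.
have {}y0 : 0 < y 0 by rewrite lt_def y0; lra.
by rewrite -mulrDl ler_pM2r ?invr_gt0 // ler_pdivrMr // mul1r divr_ge0 // ltW.
Qed.

End StepInequality.

(** * Two consequences of k-submodularity *)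

Section KSubmodularFunctions.
Variables (V : finType) (k : nat) (R : realType) (f : kvec k V -> R).
Hypothesis f_submod : ksubmodular f.
Implicit Types (x y s t : kvec k V) (e : V) (i j : 'I_k.+1).

Lemma kjoinE x y e : kjoin x y e =
  if x e == y e then x e else if x e == ord0 then y e
  else if y e == ord0 then x e else ord0.
Proof.
rewrite ffunE; case: (eqVneq (x e) (y e)) => [->|xy].
  rewrite setUid; case: (eqVneq (y e) ord0) => [->|y0].
    by rewrite setDv unset10.
  rewrite (_ : _ :\ _ = [set y e]) ?set1K //.
  by apply/setDidPl; rewrite disjoint_sym disjoints1 inE eq_sym.
case: (eqVneq (x e) ord0) => [x0|x0].
  rewrite (_ : _ :\ _ = [set y e]) ?set1K //.
  by apply/setP => i; rewrite !inE x0; case: (eqVneq i ord0) => [->|_] //=; rewrite -x0 (negbTE xy).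
case: (eqVneq (y e) ord0) => [y0|y0].
  rewrite (_ : _ :\ _ = [set x e]) ?set1K //.
  by apply/setP => i; rewrite !inE y0; case: (eqVneq i ord0) => [->|_] /=;
    rewrite ?orbF // -y0 eq_sym (negbTE xy).
rewrite (_ : _ :\ _ = [set x e; y e]); last first.
  by apply/setDidPl; rewrite disjoint_sym disjoints1 !inE ![ord0 == _]eq_sym negb_or x0.
by rewrite /unset1 cards2 xy.
Qed.

(** The meet of [kassign s e i] and [t] is [s] and their join is [kassign t e i]. *)
Lemma orthant_submodular s t e i :
    (forall v, s v = ord0 \/ s v = t v) -> t e = ord0 ->
  marginal f e i t <= marginal f e i s.
Proof.
move=> st te; have se : s e = ord0 by case: (st e) => ->.
have := f_submod (kassign s e i) t.
have -> : kmeet (kassign s e i) t = s.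
  apply/ffunP => v; rewrite !ffunE; case: (eqVneq v e) => [->|_].
    by rewrite te se; case: eqP.
  by case: (st v) => ->; rewrite ?eqxx //; case: eqP.
have -> : kjoin (kassign s e i) t = kassign t e i.
  apply/ffunP => v; rewrite kjoinE !ffunE; case: (eqVneq v e) => [->|_].
    by rewrite te eqxx; case: (eqVneq i ord0).
  case: (st v) => ->; rewrite eqxx //.
  by case: (eqVneq ord0 (t v)).
rewrite /marginal; lra.
Qed.

(** Meet and join both reset the conflicting values at [e] to [0], so both return [t]. *)
Lemma pairwise_monotone t e i j :
    t e = ord0 -> i != ord0 -> j != ord0 -> i != j ->
  0 <= marginal f e i t + marginal f e j t.
Proof.
move=> te i0 j0 ij; have := f_submod (kassign t e i) (kassign t e j).
have -> : kmeet (kassign t e i) (kassign t e j) = t.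
  apply/ffunP => v; rewrite !ffunE; case: (eqVneq v e) => [->|_].
    by rewrite te (negbTE ij).
  by rewrite eqxx.
have -> : kjoin (kassign t e i) (kassign t e j) = t.
  apply/ffunP => v; rewrite kjoinE !ffunE; case: (eqVneq v e) => [->|_].
    by rewrite te (negbTE ij) (negbTE i0) (negbTE j0).
  by rewrite eqxx.
rewrite /marginal; lra.
Qed.

End KSubmodularFunctions.

(** * Evolution of the expected potential *)

Section Analysis.
Variables (V : finType) (R : realType) (f : kvec 3 V -> R).
Hypothesis f_submod : ksubmodular f.
Variables (rule : V -> kvec 3 V -> 'S_3) (o : kvec 3 V) (c : R).
Hypothesis rule_sorts : forall (v : V) (s : kvec 3 V),
  s v = ord0 -> sorts_gains f v s (rule v s).
Hypotheses (c_gt0 : 0 < c) (cE : 2 * c ^+ 2 + c = 2).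
Implicit Types (s t : kvec 3 V) (v : V) (es : seq V) (mu : pmf V R).

Lemma label_neq0 i : label i != ord0.
Proof. by rewrite eq_sym neq_lift. Qed.

Lemma pairwise_monotone_label t v (sigma : 'S_3) (i j : 'I_3) :
    t v = ord0 -> i != j ->
  0 <= relabelled_gain f v t sigma i + relabelled_gain f v t sigma j.
Proof.
move=> tv ij; apply: pairwise_monotone; rewrite ?label_neq0 //.
by rewrite (inj_eq lift_inj) (inj_eq perm_inj).
Qed.

Lemma choice_prob_ge0 s v j : s v = ord0 -> 0 <= choice_prob f v s (rule v s) j.
Proof.
move=> sv; have [] := gain_ratios (rule_sorts sv).
  by move=> *; exact: pairwise_monotone_label.
exact: probs_ge0.
Qed.

Lemma choice_prob_sum s v :
  s v = ord0 -> \sum_(j < 3) choice_prob f v s (rule v s) j = 1.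
Proof.
move=> sv; have [] := gain_ratios (rule_sorts sv).
  by move=> *; exact: pairwise_monotone_label.
exact: probs_sum.
Qed.

Lemma choice_step s t v i :
    (forall w, s w = ord0 \/ s w = t w) -> t v = ord0 ->
  f (kassign t v i) + c * f s <=
  \sum_(j < 3) choice_prob f v s (rule v s) j *
    (f (kassign t v (label (rule v s j))) +
     c * f (kassign s v (label (rule v s j)))).
Proof.
move=> st tv; have sv : s v = ord0 by case: (st v) => ->.
set sigma := rule v s.
pose y := relabelled_gain f v s sigma.
pose b := relabelled_gain f v t sigma.
have y_pair i1 j1 : i1 != j1 -> 0 <= y i1 + y j1.
  exact: pairwise_monotone_label.
have b_pair i1 j1 : i1 != j1 -> 0 <= b i1 + b j1.
  exact: pairwise_monotone_label.
have b_le j : b j <= y j by exact: orthant_submodular.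
have step := probs_step c_gt0 cE (rule_sorts sv) y_pair b_le b_pair.
(* A nonzero [i] is one of the relabelled indices; for [i = ord0], one of [b 0] and [b 1] is
   nonnegative because their sum is. *)
have [j le_ij] : exists j, f (kassign t v i) <= f t + b j.
  case: (unliftP ord0 i) => [i1 ->|->].
    exists (sigma^-1%g i1).
    by rewrite /b /relabelled_gain /marginal permKV addrC subrK.
  have -> : kassign t v ord0 = t.
    by apply/ffunP => w; rewrite ffunE; case: (eqVneq w v) => [->|].
  have b01 : 0 <= b 0 + b 1 by exact: b_pair.
  by case: (lerP 0 (b 0)) => ?; [exists 0 | exists 1]; lra.
have := step j.
(* The probabilities sum to [1], so the common term [f t + c f s] splits off. *)
have -> : \sum_(j < 3) choice_prob f v s sigma j *
    (f (kassign t v (label (sigma j))) + c * f (kassign s v (label (sigma j))))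
  = (f t + c * f s) * \sum_(j < 3) choice_prob f v s sigma j +
    \sum_(j < 3) choice_prob f v s sigma j * (b j + c * y j).
  rewrite mulr_sumr -big_split /=; apply: eq_bigr => j1 _.
  rewrite /b /y /relabelled_gain /marginal; ring.
rewrite choice_prob_sum //; rewrite /choice_prob -/y; lra.
Qed.

Definition hybrid es s : kvec 3 V := [ffun v => if v \in es then o v else s v].

Definition potential es s : R := f (hybrid es s) + c * f s.

(** The hybrid vectors before and after the step both arise from [t] by assigning [v], so
    [choice_step] applies. *)
Lemma potential_step v es s :
    v \notin es -> (forall w, w \in v :: es -> s w = ord0) ->
  potential (v :: es) s <=
  \sum_(j < 3) choice_prob f v s (rule v s) j *
    potential es (kassign s v (label (rule v s j))).
Proof.
move=> ves s0; have sv : s v = ord0 by apply: s0; exact: mem_head.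
pose t := hybrid es s.
have tv : t v = ord0 by rewrite ffunE (negbTE ves).
have st w : s w = ord0 \/ s w = t w.
  rewrite ffunE; case: ifPn => wes; [left | by right].
  by apply: s0; rewrite inE wes orbT.
have hybrid_assign i : hybrid es (kassign s v i) = kassign t v i.
  apply/ffunP => w; rewrite !ffunE; case: (eqVneq w v) => [->|//].
  by rewrite (negbTE ves).
have hybrid_cons : hybrid (v :: es) s = kassign t v (o v).
  by apply/ffunP => w; rewrite !ffunE inE; case: (eqVneq w v) => [->|].
rewrite /potential hybrid_cons; apply: le_trans (choice_step _ st tv) _.
by apply: ler_sum => j _; rewrite hybrid_assign.
Qed.

(** Law of total expectation, conditioning on the vector before the step. *)
Lemma expectation_step_law mu v g :
  expectation (step_law f rule mu v) g =
  \sum_s mu s * \sum_(j < 3) choice_prob f v s (rule v s) j *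
    g (kassign s v (label (rule v s j))).
Proof.
rewrite /expectation; under eq_bigr do rewrite ffunE mulr_suml.
rewrite exchange_big; apply: eq_bigr => s _ /=.
under eq_bigr do rewrite -mulrA mulr_suml.
rewrite -mulr_sumr exchange_big; congr (_ * _); apply: eq_bigr => j _ /=.
under eq_bigr do rewrite -mulrA.
rewrite -mulr_sumr; congr (_ * _).
rewrite (bigD1 (kassign s v (label (rule v s j)))) //= eqxx mul1r big1 ?addr0 //.
by move=> x /negbTE->; rewrite mul0r.
Qed.

(** The induction generalizes over the law, keeping the invariant that vectors of nonzero mass
    vanish on the unprocessed elements; this is what lets [rule_sorts] apply at each step. *)
Lemma potential_le_output es mu :
    uniq es -> (forall s, 0 <= mu s) ->
    (forall s w, mu s != 0 -> w \in es -> s w = ord0) ->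
  expectation mu (potential es) <=
  (1 + c) * expectation (foldl (step_law f rule) mu es) f.
Proof.
elim: es mu => [|v es IH] mu /=.
  move=> _ _ _; rewrite /expectation mulr_sumr; apply: ler_sum => s _.
  rewrite /potential (_ : hybrid [::] s = s); last first.
    by apply/ffunP => w; rewrite ffunE.
  by rewrite le_eqVlt; apply/orP; left; apply/eqP; ring.
move=> /andP[ves es_uniq] mu_ge0 mu_supp.
apply: le_trans (IH _ es_uniq _ _).
- rewrite expectation_step_law; apply: ler_sum => s _.
  have [->|mus] := eqVneq (mu s) 0; first by rewrite !mul0r.
  by rewrite ler_wpM2l // potential_step // => w; exact: mu_supp.
- move=> x; rewrite ffunE; apply: sumr_ge0 => s _.
  have [->|mus] := eqVneq (mu s) 0; first by rewrite mul0r.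
  apply: mulr_ge0 => //; apply: sumr_ge0 => j _; apply: mulr_ge0 => //.
  by apply: choice_prob_ge0; apply: mu_supp; rewrite ?mem_head.
- move=> x w x_supp wes; apply/eqP; apply: contraNT x_supp => xw.
  rewrite ffunE big1 // => s _.
  have [->|mus] := eqVneq (mu s) 0; first by rewrite mul0r.
  rewrite big1 ?mulr0 // => j _; case: eqP => [xE|]; last by rewrite mulr0.
  case/negP: xw; rewrite xE ffunE (negbTE (memPn ves _ wes)).
  by rewrite (mu_supp s) // inE wes orbT.
Qed.

End Analysis.

Theorem theorem3p5 (R : realType) (V : finType) (n : nat) (e : n.-tuple V)
    (e_uniq : uniq e) (e_all : forall v : V, v \in e)
    (f : kvec 3 V -> R) (f_ge0 : forall x, 0 <= f x)
    (f_submod : ksubmodular f)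
    (o : kvec 3 V) (o_max : forall x, f x <= f o)
    (rule : V -> kvec 3 V -> 'S_3)
    (rule_sorts : forall (v : V) (s : kvec 3 V),
        s v = ord0 -> sorts_gains f v s (rule v s)) :
  (Num.sqrt 17 - 3) / 2 * f o <= expectation (output_law f rule e) f.
Proof.
pose c : R := (Num.sqrt 17 - 1) / 4.
have sqrt17 : Num.sqrt 17 ^+ 2 = 17 :> R by rewrite sqr_sqrtr // ler0n.
have sqrt17_ge0 : 0 <= Num.sqrt 17 :> R by exact: sqrtr_ge0.
have c_gt0 : 0 < c by rewrite /c; nra.
have cE : 2 * c ^+ 2 + c = 2.
  rewrite -[LHS](_ : (Num.sqrt 17 ^+ 2 - 1) / 8 = _); last by rewrite /c; field.
  by rewrite sqrt17; field.
have := potential_le_output f_submod o rule_sorts c_gt0 cE (mu := initial_law V R)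
  e_uniq.
set E := expectation (foldl _ _ _) f => main.
have {main} : expectation (initial_law V R) (potential f o c e) <= (1 + c) * E.
  apply: main.
  - by move=> s; rewrite ffunE ler0n.
  - by move=> s w; rewrite ffunE pnatr_eq0 eqb0 negbK => /eqP-> _; rewrite ffunE.
(* The initial law is a point mass and [e] lists all of [V], so the initial potential is [f o] plus
   [c] times the nonnegative value of [f] at the zero vector. *)
rewrite /expectation (bigD1 [ffun=> ord0]) //= big1 ?addr0; last first.
  by move=> s /negbTE s0; rewrite ffunE s0 mul0r.
rewrite ffunE eqxx mul1r /potential (_ : hybrid o e _ = o); last first.
  by apply/ffunP => v; rewrite ffunE e_all.
move=> main; rewrite /output_law -/E.
have f0 : 0 <= c * f [ffun=> ord0] by rewrite mulr_ge0 // ltW.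
rewrite (_ : (_ - 3) / 2 = 2 * c - 1); last by rewrite /c; field.
(* By [cE], [(2 c - 1) (1 + c) = 2 c^2 + c - 1 = 1]. *)
have -> : E = (2 * c - 1) * ((1 + c) * E).
  have -> : (2 * c - 1) * ((1 + c) * E) = (2 * c ^+ 2 + c - 1) * E by ring.
  by rewrite cE; ring.
apply: ler_wpM2l; [nra | lra].
Qed.
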